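(* Let $n\ge 4$. Let $P_n^{n-2}$ be the tree obtained from the path $P_3$ on three vertices by adding $n-3$ new vertices, each adjacent only to one fixed end vertex of $P_3$. Then $P_n^{n-2}$ is, up to isomorphism, the unique graph attaining the maximum algebraic connectivity over $\mathfrak{H}_{n,n-2}$.
   Context: All graphs are finite, simple and undirected. The Laplacian matrix of $G$ is $L(G)=D(G)-A(G)$ (degree matrix minus adjacency matrix), and the algebraic connectivity $\mu(G)$ is the second smallest eigenvalue of $L(G)$. A pendant vertex is a vertex of degree one. $\mathfrak{H}_{n,k}$ denotes the class of all connected graphs on $n$ vertices having exactly $k$ pendant vertices. *)

(* Defs.v *)
From mathcomp Require Import all_boot all_order all_algebra.
From mathcomp Require Import polyrcf.

Set Implicit Arguments.
Unset Strict Implicit.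
Unset Printing Implicit Defensive.

Import Order.TTheory GRing.Theory Num.Theory.

Local Open Scope ring_scope.

Record sgraph := SGraph {
  vertex :> finType;
  adj : rel vertex;
  adj_sym : symmetric adj;
  adj_irrefl : irreflexive adj }.

Definition deg (G : sgraph) (x : G) : nat := #|[set y | adj x y]|.

Definition pendant (G : sgraph) : {set G} := [set x | deg x == 1%N].

Definition connected (G : sgraph) : Prop :=
  (0 < #|G|)%N /\ forall x y : G, connect (@adj G) x y.

Definition isomorphic (G H : sgraph) : Prop :=
  exists2 f : G -> H, bijective f & {mono f : x y / adj x y}.

(* Matrices are indexed by ordinals: row and column i stand for the vertex
   enum_val i. *)
Definition adj_mx (R : nzRingType) (G : sgraph) : 'M[R]_#|G| :=
  \matrix_(i, j) (adj (enum_val i : G) (enum_val j))%:R.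

Definition deg_mx (R : nzRingType) (G : sgraph) : 'M[R]_#|G| :=
  diag_mx (\row_i (deg (enum_val i : G))%:R).

Definition laplacian (R : nzRingType) (G : sgraph) : 'M[R]_#|G| :=
  deg_mx R G - adj_mx R G.

(* The eigenvalues of A that lie in R, in nondecreasing order, each repeated
   according to its multiplicity as a root of the characteristic polynomial
   (rootsR lists the distinct roots in increasing order). For a symmetric A
   these are all the eigenvalues; see also spectrumP. *)
Definition spectrum (R : rcfType) (n : nat) (A : 'M[R]_n) : seq R :=
  flatten [seq nseq (mup x (char_poly A)) x | x <- rootsR (char_poly A)].

Lemma count_spectrum (R : rcfType) (n : nat) (A : 'M[R]_n) (x : R) :
  count_mem x (spectrum A) = mup x (char_poly A).
Proof.
rewrite /spectrum; set p := char_poly A.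
have p0 : p != 0 by rewrite monic_neq0 ?char_poly_monic.
have rP : root p x = (x \in rootsR p) by rewrite -roots_on_rootsR.
have := uniq_roots (- cauchy_bound p) (cauchy_bound p) p.
rewrite -/(rootsR p) count_flatten -map_comp sumnE big_map => ur.
case: (boolP (x \in rootsR p)) => xr.
  rewrite (bigD1_seq x) //= count_nseq /= eqxx mul1n big1 ?addn0 // => y yx.
  by rewrite count_nseq /= (negPf yx).
rewrite mupNroot ?rP // big_seq big1 // => y yr.
rewrite /= count_nseq /=; case: eqP => // yx.
by rewrite -yx yr in xr.
Qed.

Lemma sorted_spectrum (R : rcfType) (n : nat) (A : 'M[R]_n) :
  sorted <=%R (spectrum A).
Proof.
rewrite /spectrum; set p := char_poly A.
have : sorted <%R (rootsR p) by apply: sorted_roots.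
rewrite !sorted_pairwise; [|exact: le_trans|exact: lt_trans].
elim: (rootsR p) => //= x s IHs /andP[xs /IHs {}IHs].
rewrite pairwise_cat IHs andbT; apply/andP; split.
  apply/allrelP => a b /nseqP[-> _] /flatten_mapP[y ys /nseqP[-> _]].
  by apply: ltW; exact: (allP xs).
elim: (mup x p) => //= m ->; rewrite andbT.
by apply/allP => y /nseqP[-> _].
Qed.

Lemma spectrumP (R : rcfType) (n : nat) (A : 'M[R]_n) (s : seq R) :
  sorted <=%R s -> char_poly A = \prod_(x <- s) ('X - x%:P) ->
  spectrum A = s.
Proof.
move=> ss As; apply: (sorted_eq le_trans le_anti (sorted_spectrum A) ss).
by apply/allP => x _ /=; rewrite count_spectrum As mu_prod_XsubC.
Qed.

(* The default value 0 is only used on graphs with fewer than two vertices. *)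
Definition algebraic_connectivity (R : rcfType) (G : sgraph) : R :=
  nth 0 (spectrum (laplacian R G)) 1.

Definition conn_pendant_class (n k : nat) (G : sgraph) : Prop :=
  [/\ connected G, #|G| = n & #|pendant G| = k].

Definition attains_max_connectivity (R : rcfType) (C : sgraph -> Prop)
    (G : sgraph) : Prop :=
  C G /\
  forall H, C H -> algebraic_connectivity R H <= algebraic_connectivity R G.

Definition path_rel (m : nat) : rel 'I_m :=
  fun i j => (i.+1 == j :> nat) || (j.+1 == i :> nat).

Lemma path_rel_sym (m : nat) : symmetric (@path_rel m).
Proof. by move=> i j; rewrite /path_rel orbC. Qed.

Lemma path_rel_irrefl (m : nat) : irreflexive (@path_rel m).
Proof. by move=> i; rewrite /path_rel orbb eqn_leq ltnn. Qed.

Definition path_graph (m : nat) : sgraph :=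
  SGraph (@path_rel_sym m) (@path_rel_irrefl m).

Definition add_pendants_rel (G : sgraph) (v : G) (k : nat) : rel (G + 'I_k) :=
  fun x y => match x, y with
  | inl a, inl b => adj a b
  | inl a, inr _ => a == v
  | inr _, inl b => b == v
  | inr _, inr _ => false
  end.

Lemma add_pendants_sym (G : sgraph) (v : G) (k : nat) :
  symmetric (@add_pendants_rel G v k).
Proof. by case=> [a|i] [b|j] //=; exact: adj_sym. Qed.

Lemma add_pendants_irrefl (G : sgraph) (v : G) (k : nat) :
  irreflexive (@add_pendants_rel G v k).
Proof. by case=> [a|i] //=; exact: adj_irrefl. Qed.

(* G with k new vertices, each adjacent to v only. *)
Definition add_pendants (G : sgraph) (v : G) (k : nat) : sgraph :=
  SGraph (@add_pendants_sym G v k) (@add_pendants_irrefl G v k).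

(* P_n^{n-2}, for n >= 3; ord0 is an end vertex of the path 0 - 1 - 2. *)
Definition P_broom (n : nat) : sgraph :=
  @add_pendants (path_graph 3) ord0 (n - 3).

(* Main.v *)
Require Import Defs.
From mathcomp Require Import all_boot all_order all_algebra.
From mathcomp Require Import polyrcf ring lra zify.

(* A connected graph on n >= 4 vertices with n - 2 pendant ones is a double
   star: its two other vertices are adjacent and carry all the leaves.  If they
   have degrees p and q (so p + q = n), eliminating the leaves from the eigenvector
   equations shows that each Laplacian eigenvalue is 0, 1 or a root of
     g(x) = x^3 - (n + 2) x^2 + (n + 2 + p q) x - n.
   The eigenvalue 0 is simple and g has a root in ]0, 1[, so the algebraic
   connectivity is a root of g in ]0, 1[.  There g is increasing in x and in
   p q, hence the connectivity strictly decreases with p q, which is minimal exactly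
   when p = 2 or q = 2, i.e. for the broom. *)

Set Implicit Arguments.
Unset Strict Implicit.
Unset Printing Implicit Defensive.

Import Order.TTheory GRing.Theory Num.Theory.

Local Open Scope ring_scope.

(** * Characteristic polynomials and the multiplicity of the root 0 *)

Lemma char_poly_conj (F : fieldType) (n : nat) (A P Q : 'M[F]_n) :
  P *m Q = 1%:M -> char_poly (P *m A *m Q) = char_poly A.
Proof.
move=> PQ1; rewrite /char_poly.
have -> : char_poly_mx (P *m A *m Q)
    = map_mx polyC P *m char_poly_mx A *m map_mx polyC Q.
  rewrite /char_poly_mx mulmxBr mulmxBl !map_mxM /= scalar_mxC -(mulmxA _%:M).
  by rewrite -(map_mxM _ P Q) PQ1 map_mx1 mulmx1.
by rewrite !det_mulmx mulrAC -det_mulmx -(map_mxM _ P Q) PQ1 map_mx1 det1 mul1r.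
Qed.

Lemma char_poly_lblock (F : comNzRingType) (n1 n2 : nat)
    (A : 'M[F]_n1) (C : 'M[F]_(n2, n1)) (B : 'M[F]_n2) :
  char_poly (block_mx A 0 C B) = char_poly A * char_poly B.
Proof.
rewrite /char_poly /char_poly_mx map_block_mx /= map_mx0 scalar_mx_block.
by rewrite opp_block_mx add_block_mx subr0 det_lblock.
Qed.

(* Conjugating A by the shear whose first row is the all-ones vector splits off a
   null first row; a null vector of the remaining block B would contradict the
   one-dimensionality of the kernel, so 0 is not a root of char_poly B. *)
Lemma mup0_char_poly1 (F : fieldType) (n : nat) (A : 'M[F]_n) :
  n%:R != 0 :> F ->
  (const_mx 1 : 'rV_n) *m A = 0 -> A *m (const_mx 1 : 'cV_n) = 0 ->
  (forall v : 'rV_n, v *m A = 0 -> exists c, v = const_mx c) ->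
  mup 0 (char_poly A) = 1%N.
Proof.
case: n A => [|m] A; first by rewrite eqxx.
rewrite -[m.+1]/(1 + m)%N in A *.
move=> n0 uA Au kerA.
pose w : 'rV[F]_m := const_mx 1.
pose P : 'M[F]_(1 + m) := block_mx 1%:M w 0 1%:M.
pose Q : 'M[F]_(1 + m) := block_mx 1%:M (- w) 0 1%:M.
have PQ1 : P *m Q = 1%:M.
  rewrite mulmx_block !(mul1mx, mulmx1, mulmx0, mul0mx, addr0, add0r).
  by rewrite addNr -scalar_mx_block.
have QP1 : Q *m P = 1%:M by exact: mulmx1C.
have uE : (const_mx 1 : 'rV[F]_(1 + m)) = usubmx P.
  rewrite col_mxKu; apply/rowP => j; rewrite !mxE.
  by case: split => i; rewrite ?mxE ?ord1 ?eqxx.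
set B := drsubmx (P *m A *m Q).
have PAQ : P *m A *m Q = block_mx (0 : 'M_1) 0 (dlsubmx (P *m A *m Q)) B.
  rewrite -[LHS]submxK -/B.
  have u0 : usubmx (P *m A *m Q) = 0.
    by rewrite -!mul_usub_mx -uE uA mul0mx.
  by rewrite /ulsubmx /ursubmx u0 !linear0.
have B0 : ~~ root (char_poly B) 0.
  rewrite -eigenvalue_root_char; apply/negP => /eigenvalueP[v].
  rewrite scale0r => vB v0.
  (* [z] is [row_mx 0 v] in the original coordinates. The row [z *m A] is a multiple of the all-ones
     row. Its product with the all-ones column is 0, and the dimension is nonzero in [F], so the
     multiple is 0 and [z] lies in the kernel. *)
  pose z : 'rV[F]_(1 + m) := row_mx 0 v *m P.
  have zA : z *m A = v *m dlsubmx (P *m A *m Q) *m const_mx 1.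
    have : z *m A *m Q = row_mx (v *m dlsubmx (P *m A *m Q)) 0.
      rewrite /z -!mulmxA [P *m _]mulmxA PAQ mul_row_block block_mxKdl.
      by rewrite !mul0mx !add0r vB.
    move=> /(congr1 (mulmx^~ P)); rewrite -!mulmxA QP1 !mulmx1 => ->.
    rewrite mul_row_block !mul0mx !addr0 mulmx1 uE col_mxKu.
    by rewrite mul_mx_row mulmx1 mul_mx_row !mulmxA.
  have d0 : v *m dlsubmx (P *m A *m Q) = 0.
    have : z *m A *m const_mx 1 = 0 :> 'M_1 by rewrite -mulmxA Au mulmx0.
    rewrite zA -mulmxA.
    have -> : (const_mx 1 : 'rV[F]_(1 + m)) *m (const_mx 1 : 'cV[F]_(1 + m))
        = (1 + m)%:R%:M.
      apply/matrixP => i j; rewrite !mxE !ord1 eqxx mulr1n.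
      under eq_bigr do rewrite !mxE mulr1.
      by rewrite sumr_const card_ord.
    by rewrite mul_mx_scalar => /eqP; rewrite scaler_eq0 (negPf n0) => /eqP.
  have [c zc] : exists c, z = const_mx c by apply: kerA; rewrite zA d0 mul0mx.
  (* A constant row is a multiple of the first row of [P], so in the new coordinates its last [m]
     entries vanish. This contradicts [v != 0]. *)
  have {zc} : row_mx 0 v = const_mx c *m Q.
    by rewrite -zc /z -mulmxA PQ1 mulmx1.
  have -> : (const_mx c : 'rV[F]_(1 + m)) = row_mx c%:M (c *: w).
    apply/rowP => j; rewrite !mxE; case: split => i; rewrite !mxE ?mulr1 //.
    by rewrite !ord1 eqxx mulr1n.
  rewrite mul_row_block !mulmx0 !mulmx1 addr0 => /eq_row_mx[_ vE].
  by move: v0; rewrite vE mul_scalar_mx scalerN addNr eqxx.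
rewrite -(char_poly_conj A PQ1) PAQ char_poly_lblock mupMl //.
have -> : char_poly (0 : 'M[F]_1) = ('X - 0%:P) ^+ 1.
  by rewrite char_poly_trig ?big_ord1 ?mxE ?mx0_is_trig.
by rewrite mup_XsubCX eqxx.
Qed.

(** * The Laplacian acting on functions on the vertices *)

(** Rows are used because [eigenvalue] refers to left eigenvectors; the symmetry of [adj] turns sums
    down a column into sums over neighbours. *)
Lemma laplacianE (R : nzRingType) (G : sgraph) (f : G -> R) :
  (\row_i f (enum_val i)) *m laplacian R G
    = \row_i \sum_(y | adj (enum_val i) y) (f (enum_val i) - f y).
Proof.
apply/rowP => i; rewrite /laplacian mulmxBr mul_mx_diag !mxE sumrB.
rewrite sumr_const /deg cardsE mulr_natr; congr (_ - _).
rewrite (reindex (@enum_val _ _ : 'I_#|G| -> G)) /=;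
  last exact/onW_bij/enum_val_bij.
rewrite [RHS]big_mkcond /=; apply: eq_bigr => j _; rewrite !mxE adj_sym.
by case: ifP => _; rewrite ?mulr1 ?mulr0.
Qed.

Lemma laplacian_eigenvalueP (F : fieldType) (G : sgraph) (l : F) :
  reflect (exists2 f : G -> F, exists x, f x != 0
             & forall x, \sum_(y | adj x y) (f x - f y) = l * f x)
    (eigenvalue (laplacian F G) l).
Proof.
apply: (iffP eigenvalueP) => [[v vL v0]|[f [x fx0] fL]].
  pose f (x : G) := v 0 (enum_rank x).
  have vE : v = \row_i f (enum_val i).
    by apply/rowP => i; rewrite mxE /f enum_valK.
  exists f.
    have /rV0Pn[i vi] := v0.
    by exists (enum_val i); rewrite /f enum_valK.
  move=> x; move: vL; rewrite {1}vE laplacianE => /rowP/(_ (enum_rank x)).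
  by rewrite !mxE enum_rankK.
exists (\row_i f (enum_val i)).
  by rewrite laplacianE; apply/rowP => i; rewrite !mxE fL.
by apply/rV0Pn; exists (enum_rank x); rewrite mxE enum_rankK.
Qed.

(** * Double stars: adjacency, degrees and sums over neighbours *)

(* A double star with centres a and b is encoded by the map c sending each leaf
   to the centre it hangs from and exchanging the two centres: the edges are
   then exactly the pairs {x, c x}. *)
Record double_star (G : sgraph) (a b : G) (c : G -> G) : Prop := DoubleStar {
  dstar_neq : a != b;
  dstar_a : c a = b;
  dstar_b : c b = a;
  dstar_hub : forall x, (c x == a) || (c x == b);
  dstar_adj : forall x y, adj x y = (c x == y) || (c y == x) }.

Lemma double_starC (G : sgraph) (a b : G) (c : G -> G) :
  double_star a b c -> double_star b a c.
Proof.
by case=> ab ca cb h e; split=> // [|x]; [rewrite eq_sym | rewrite orbC].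
Qed.

Lemma dstar_adj_hub (G : sgraph) (a b : G) (c : G -> G) :
  double_star a b c -> forall y, adj a y = (c y == a).
Proof.
case=> ab ca cb h e y; rewrite e ca; case: eqP => //= <-.
by rewrite cb eqxx.
Qed.

Lemma dstar_adj_leaf (G : sgraph) (a b : G) (c : G -> G) :
  double_star a b c ->
  forall x, x != a -> x != b -> forall y, adj x y = (y == c x).
Proof.
case=> ab ca cb h e x xa xb y; rewrite e eq_sym; case: eqP => //= _.
by case/orP: (h y) => /eqP->; rewrite eq_sym; apply/negbTE.
Qed.

Lemma dstar_sum_hub (G : sgraph) (a b : G) (c : G -> G) (V : nmodType)
    (F : G -> V) : double_star a b c ->
  \sum_(y | adj a y) F y = F b + \sum_(y | (c y == a) && (y != b)) F y.
Proof.
move=> ds; rewrite (eq_bigl _ _ (dstar_adj_hub ds)).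
by rewrite (bigD1 b) //= (dstar_b ds).
Qed.

Lemma dstar_card_leaves (G : sgraph) (a b : G) (c : G -> G) :
  double_star a b c ->
  #|[pred y | (c y == a) && (y != b)]| = (deg a).-1.
Proof.
move=> ds; rewrite /deg (cardsD1 b) inE (dstar_adj_hub ds) (dstar_b ds) eqxx.
rewrite add1n /=; apply: eq_card => y.
by rewrite !inE (dstar_adj_hub ds) andbC.
Qed.

Lemma dstar_deg_gt0 (G : sgraph) (a b : G) (c : G -> G) :
  double_star a b c -> (0 < deg a)%N.
Proof.
move=> ds; apply/card_gt0P; exists b.
by rewrite inE (dstar_adj_hub ds) (dstar_b ds).
Qed.

(** The neighbourhoods of the centres are the two fibres of [c], each centre lying in the fibre over
    the other; they partition the vertices. *)
Lemma dstar_degD (G : sgraph) (a b : G) (c : G -> G) :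
  double_star a b c -> (deg a + deg b = #|G|)%N.
Proof.
move=> ds; have ds' := double_starC ds.
rewrite -(cardsC [set y | adj a y]); congr addn.
apply: eq_card => y; rewrite !inE (dstar_adj_hub ds') (dstar_adj_hub ds).
have ab := negbTE (dstar_neq ds).
by case/orP: (dstar_hub ds y) => /eqP->; rewrite eqxx ?ab // eq_sym ab.
Qed.

Lemma dstar_sum_leaf (G : sgraph) (a b : G) (c : G -> G) (V : nmodType)
    (F : G -> V) : double_star a b c ->
  forall x, x != a -> x != b -> \sum_(y | adj x y) F y = F (c x).
Proof.
by move=> ds x xa xb; rewrite (eq_bigl _ _ (dstar_adj_leaf ds xa xb)) big_pred1_eq.
Qed.

(** * Laplacian eigenvalues of a double star *)

Lemma dstar_eigen_leaf (F : fieldType) (G : sgraph) (a b : G) (c : G -> G)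
    (l : F) (f : G -> F) : double_star a b c ->
  (forall x, \sum_(y | adj x y) (f x - f y) = l * f x) ->
  forall x, x != a -> x != b -> (1 - l) * f x = f (c x).
Proof.
move=> ds fL x xa xb; move: (fL x); rewrite (dstar_sum_leaf _ ds) // => e.
by rewrite mulrBl mul1r -e; ring.
Qed.

(** Multiplying the equation at [a] by [1 - l] allows the leaf equation to be used without division:
    each leaf at [a] then contributes [- l * f a]. *)
Lemma dstar_eigen_hub (F : fieldType) (G : sgraph) (a b : G) (c : G -> G)
    (l : F) (f : G -> F) : double_star a b c ->
  (forall x, \sum_(y | adj x y) (f x - f y) = l * f x) ->
  (1 - l) * f b = (l ^+ 2 - ((deg a)%:R + 1) * l + 1) * f a.
Proof.
move=> ds fL; move: (fL a); rewrite (dstar_sum_hub _ ds) => e.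
have {e} : (1 - l) * (f a - f b) - (deg a).-1%:R * (l * f a)
    = (1 - l) * (l * f a).
  rewrite -[in RHS]e [RHS]mulrDr mulr_sumr; congr (_ + _).
  rewrite -(dstar_card_leaves ds) mulr_natl -mulNrn -sumr_const.
  apply: eq_bigr => y; rewrite inE => /andP[/eqP cy yb].
  have ya : y != a.
    apply/eqP => yE; move: cy; rewrite yE (dstar_a ds) => /eqP.
    by rewrite eq_sym (negPf (dstar_neq ds)).
  by rewrite mulrBr (dstar_eigen_leaf ds fL ya yb) cy; ring.
have /prednK <- := dstar_deg_gt0 ds.
rewrite -natr1 => e; apply/eqP; rewrite -subr_eq0; apply/eqP.
move/eqP: e; rewrite -subr_eq0 => /eqP e.
by rewrite -[RHS]oppr0 -e; ring.
Qed.

Definition dstar_cubic (R : nzRingType) (n m x : R) : R :=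
  x ^+ 3 - (n + 2) * x ^+ 2 + (n + 2 + m) * x - n.

(** The left side is, up to sign, the determinant of the two centre equations in the unknowns [f a]
    and [f b]; the factor [x] accounts for the constant eigenvectors. *)
Lemma dstar_cubicE (F : comNzRingType) (p q x : F) :
  (x ^+ 2 - (p + 1) * x + 1) * (x ^+ 2 - (q + 1) * x + 1) - (1 - x) ^+ 2
    = x * dstar_cubic (p + q) (p * q) x.
Proof. by rewrite /dstar_cubic; ring. Qed.

Lemma dstar_eigenvalue (F : fieldType) (G : sgraph) (a b : G) (c : G -> G)
    (l : F) : double_star a b c -> eigenvalue (laplacian F G) l ->
  [\/ l = 0, l = 1 | dstar_cubic #|G|%:R (deg a * deg b)%:R l = 0].
Proof.
move=> ds /laplacian_eigenvalueP[f [x fx0] fL].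
have ha := dstar_eigen_hub ds fL.
have hb := dstar_eigen_hub (double_starC ds) fL.
have hl := dstar_eigen_leaf ds fL.
have [l1|l1] := eqVneq l 1; first by constructor 2.
have l1' : 1 - l != 0 by rewrite subr_eq0 eq_sym.
(* For [l != 1], vanishing at [a] spreads to [b] by the centre equation and then to every leaf. *)
have fa0 : f a != 0.
  apply: contra_neq fx0 => fa0; rewrite fa0 mulr0 in ha.
  have fb0 : f b = 0 by move/eqP: ha; rewrite mulf_eq0 (negPf l1') => /eqP.
  have [->//|xa] := eqVneq x a; have [->//|xb] := eqVneq x b.
  have := hl x xa xb; have -> : f (c x) = 0.
    by case/orP: (dstar_hub ds x) => /eqP->.
  by move/eqP; rewrite mulf_eq0 (negPf l1') => /eqP.
have : l * dstar_cubic #|G|%:R (deg a * deg b)%:R l * f a = 0.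
  rewrite -(dstar_degD ds) natrD natrM -dstar_cubicE mulrBl mulrAC -ha.
  by rewrite mulrAC -mulrA -hb; ring.
move/eqP; rewrite !mulf_eq0 (negPf fa0) orbF => /orP[]/eqP ?.
  by constructor 1.
by constructor 3.
Qed.

(** At [l = 0] the leaf equation reads [f x = f (c x)] and the centre equation reads [f b = f a]. *)
Lemma dstar_harmonic (F : fieldType) (G : sgraph) (a b : G) (c : G -> G)
    (f : G -> F) : double_star a b c ->
  (forall x, \sum_(y | adj x y) (f x - f y) = 0) -> forall x, f x = f a.
Proof.
move=> ds fL.
have {}fL x : \sum_(y | adj x y) (f x - f y) = 0 * f x by rewrite fL mul0r.
have ba : f b = f a.
  by have := dstar_eigen_hub ds fL; rewrite subr0 mulr0 subr0 expr0n add0r !mul1r.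
move=> x; have [->//|xa] := eqVneq x a; have [->//|xb] := eqVneq x b.
have := dstar_eigen_leaf ds fL xa xb; rewrite subr0 mul1r => ->.
by case/orP: (dstar_hub ds x) => /eqP->.
Qed.

Lemma dstar_mup0 (F : numFieldType) (G : sgraph) (a b : G) (c : G -> G) :
  double_star a b c -> mup 0 (char_poly (laplacian F G)) = 1%N.
Proof.
move=> ds.
have L1 : (const_mx 1 : 'rV_#|G|) *m laplacian F G = 0.
  have -> : const_mx 1 = \row_(i < #|G|) (1 : F) by apply/rowP => i; rewrite !mxE.
  rewrite (laplacianE (fun=> 1)); apply/rowP => i; rewrite !mxE big1 // => *.
  by rewrite subrr.
apply: mup0_char_poly1 => //.
- by rewrite pnatr_eq0 -lt0n; apply/card_gt0P; exists a.
- apply: trmx_inj; rewrite trmx_mul trmx_const trmx0 -[RHS]L1; congr (_ *m _).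
  rewrite /laplacian linearB /= tr_diag_mx; congr (_ - _).
  by apply/matrixP => i j; rewrite !mxE adj_sym.
move=> v vL; pose f (x : G) := v 0 (enum_rank x).
have vE : v = \row_i f (enum_val i).
  by apply/rowP => i; rewrite mxE /f enum_valK.
exists (f a); rewrite vE; apply/rowP => i; rewrite !mxE.
apply: (dstar_harmonic ds) => x.
move: vL; rewrite vE laplacianE => /rowP/(_ (enum_rank x)).
by rewrite !mxE enum_rankK.
Qed.

(** The eigenvector is explicit. Starting from the value [(1 - l) ^+ 2] at [a], the equations at [a]
    and at the leaves dictate the other values without division; [l != 1] makes it nonzero. *)
Lemma dstar_cubic_eigenvalue (F : fieldType) (G : sgraph) (a b : G)
    (c : G -> G) (l : F) : double_star a b c -> l != 1 ->
  dstar_cubic #|G|%:R (deg a * deg b)%:R l = 0 ->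
  eigenvalue (laplacian F G) l.
Proof.
move=> ds l1 gl; have ds' := double_starC ds.
have ab := negbTE (dstar_neq ds); have ba := negbTE (dstar_neq ds').
have l1' : 1 - l != 0 by rewrite subr_eq0 eq_sym.
pose v := l ^+ 2 - ((deg a)%:R + 1) * l + 1.
pose f x := if x == a then (1 - l) ^+ 2 else if x == b then (1 - l) * v
            else if c x == a then 1 - l else v.
have fa : f a = (1 - l) ^+ 2 by rewrite /f eqxx.
have fb : f b = (1 - l) * v by rewrite /f ba eqxx.
apply/laplacian_eigenvalueP; exists f.
  by exists a; rewrite fa expf_neq0.
move=> x; have [->|xa] := eqVneq x a.
  rewrite (dstar_sum_hub _ ds) (eq_bigr (fun=> (1 - l) ^+ 2 - (1 - l))); last first.
    move=> y /andP[/eqP cy yb]; rewrite fa /f cy eqxx (negPf yb).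
    by case: (y =P a) cy => // ->; rewrite (dstar_a ds) => /eqP; rewrite ba.
  rewrite sumr_const (dstar_card_leaves ds) fa fb /v.
  have /prednK <- := dstar_deg_gt0 ds.
  by rewrite -[_ *+ (deg a).-1]mulr_natr -natr1; ring.
have [->|xb] := eqVneq x b.
  rewrite (dstar_sum_hub _ ds') (eq_bigr (fun=> (1 - l) * v - v)); last first.
    move=> y /andP[/eqP cy ya]; rewrite fb /f cy ba (negPf ya).
    by case: (y =P b) cy => // ->; rewrite (dstar_b ds) => /eqP; rewrite ab.
  rewrite sumr_const (dstar_card_leaves ds') fa fb.
  (* The equation at [b] is where the cubic enters: it amounts to the vanishing of the
     determinant. *)
  have := dstar_cubicE (deg a)%:R (deg b)%:R l.
  rewrite -natrD -natrM (dstar_degD ds) gl mulr0 -/v => /eqP.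
  rewrite subr_eq0 => /eqP <-; have /prednK <- := dstar_deg_gt0 ds'.
  by rewrite -[_ *+ (deg b).-1]mulr_natr -natr1; ring.
rewrite (dstar_sum_leaf _ ds) //.
case/orP: (dstar_hub ds x) => /eqP cx; rewrite cx ?fa ?fb /f (negPf xa) (negPf xb) cx
  ?eqxx ?ba; ring.
Qed.

(** * Location and monotonicity of the roots of the cubic *)

(** Intermediate values: the cubic is [- n] at 0 and [1 + m - n] at 1. *)
Lemma dstar_cubic_root (R : rcfType) (n m : R) : 0 < n -> n <= m ->
  exists2 x, 0 < x < 1 & dstar_cubic n m x = 0.
Proof.
move=> n0 nm.
pose p : {poly R} := 'X^3 - (n + 2)%:P * 'X^2 + (n + 2 + m)%:P * 'X - n%:P.
have pE x : p.[x] = dstar_cubic n m x by rewrite /p /dstar_cubic !hornerE.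
have [||x] := @poly_ivtoo R p 0 1; rewrite ?ler01 //.
  by rewrite !pE /dstar_cubic; nra.
by rewrite in_itv /= => x01 /rootP; rewrite pE; exists x.
Qed.

(** For [x <= 0] the terms in [x] are all nonpositive and the constant term is negative. This yields
    the nonnegativity of the spectrum. *)
Lemma dstar_cubic_gt0 (R : realFieldType) (n m x : R) : 0 < n -> 0 <= m ->
  dstar_cubic n m x = 0 -> 0 < x.
Proof.
rewrite /dstar_cubic => n0 m0 e; rewrite ltNge; apply/negP => x0.
have : 0 <= (n + 2) * x ^+ 2 by rewrite mulr_ge0 ?sqr_ge0 //; lra.
have : x ^+ 3 <= 0 by rewrite exprS mulr_le0_ge0 // sqr_ge0.
have : (n + 2 + m) * x <= 0 by rewrite mulr_ge0_le0 //; lra.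
lra.
Qed.

Lemma dstar_cubic_root_le (R : realFieldType) (n m1 m2 x y : R) :
  1 <= n -> n <= m1 -> m1 <= m2 -> 0 < x < 1 -> 0 < y < 1 ->
  dstar_cubic n m1 x = 0 -> dstar_cubic n m2 y = 0 ->
  y <= x ?= iff (m1 == m2).
Proof.
move=> n1 nm m12 /andP[x0 x1] /andP[y0 y1] gx gy.
(* [h] is the divided difference of the cubic with parameter [m1] at [x] and [y], expanded in
   [1 - x] and [1 - y] so that its positivity on the unit interval is visible. *)
set h := (m1 - n + 1) + (n - 1) * ((1 - x) + (1 - y))
         + ((1 - x) ^+ 2 + (1 - x) * (1 - y) + (1 - y) ^+ 2).
have h0 : 0 < h.
  have t1 : 0 <= (n - 1) * ((1 - x) + (1 - y)) by rewrite mulr_ge0 //; lra.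
  have t2 : 0 <= (1 - x) * (1 - y) by rewrite mulr_ge0 //; lra.
  by have := sqr_ge0 (1 - x); have := sqr_ge0 (1 - y); rewrite /h; lra.
have e : (x - y) * h = (m2 - m1) * y.
  apply/eqP; rewrite -subr_eq0; apply/eqP.
  rewrite -[RHS](subrr (0 : R)) -{1}gx -gy /h /dstar_cubic; ring.
have ge0 : 0 <= (m2 - m1) * y by apply: mulr_ge0; [rewrite subr_ge0 | exact: ltW].
split; first by rewrite -subr_ge0 -(pmulr_lge0 _ h0) e.
rewrite eq_sym -subr_eq0 -(mulIr_eq0 (x - y) (mulIf (lt0r_neq0 h0))) e.
by rewrite mulf_eq0 (gt_eqF y0) orbF subr_eq0 eq_sym.
Qed.

(** * The algebraic connectivity of a double star *)

(** The list starts with its only 0, so the entry of index 1 is the least positive one; the member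
    [r] ensures that this entry exists and is not the default. *)
Lemma sorted_nth1 (R : realDomainType) (s : seq R) (r : R) :
  sorted <=%R s -> {in s, forall x, 0 <= x} -> count_mem 0 s = 1%N ->
  r \in s -> 0 < r -> [/\ nth 0 s 1 \in s, 0 < nth 0 s 1 & nth 0 s 1 <= r].
Proof.
case: s => [//|x s] /= xs s0 c1; rewrite inE => rs r0.
have x_min : all (>= x) s by apply: order_path_min xs; exact: le_trans.
have x0 : x = 0.
  apply/eqP; rewrite eq_le s0 ?mem_head // andbT leNgt; apply/negP => x_gt0.
  suff : ((x == 0%R) + count_mem 0%R s)%N = 0%N by rewrite c1.
  rewrite gt_eqF // add0n; apply/count_memPn/negP => /(allP x_min).
  by rewrite leNgt x_gt0.
have {}rs : r \in s by case/predU1P: rs => // rx; rewrite rx x0 ltxx in r0.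
case: s => [//|y s] /= in xs s0 c1 x_min rs *; rewrite !inE eqxx orbT.
have y_min : all (>= y) s.
  by case/andP: xs => _ ys; apply: order_path_min ys; exact: le_trans.
split=> //; last by case/predU1P: rs => [->//|/(allP y_min)].
rewrite lt_def s0 ?inE ?eqxx ?orbT // andbT.
by apply: contra_eq_neq c1 => ->; rewrite x0 eqxx.
Qed.

Lemma dstar_connectivity (R : rcfType) (G : sgraph) (a b : G) (c : G -> G) :
  double_star a b c -> (#|G| <= deg a * deg b)%N ->
  0 < algebraic_connectivity R G < 1 /\
  dstar_cubic #|G|%:R (deg a * deg b)%:R (algebraic_connectivity R G) = 0.
Proof.
move=> ds le_ab; rewrite /algebraic_connectivity.
set L := laplacian R G; set s := spectrum L.
have G0 : 0 < #|G|%:R :> R by rewrite ltr0n; apply/card_gt0P; exists a.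
have sE x : (x \in s) = eigenvalue L x.
  rewrite eigenvalue_root_char -has_pred1 has_count count_spectrum.
  by rewrite -XsubC_dvd ?dvdp_XsubCl //; exact: monic_neq0 (char_poly_monic _).
have sP x : x \in s ->
    [\/ x = 0, x = 1 | dstar_cubic #|G|%:R (deg a * deg b)%:R x = 0].
  by rewrite sE; exact: (dstar_eigenvalue ds).
have gP x := dstar_cubic_gt0 (x := x) G0 (ler0n R (deg a * deg b)).
have [||r /andP[r0 r1] gr] := @dstar_cubic_root R #|G|%:R (deg a * deg b)%:R => //.
  by rewrite ler_nat.
have [||||] // := @sorted_nth1 R s r (sorted_spectrum L).
- move=> x /sP[->|->|/gP/ltW] //; exact: ler01.
- by rewrite count_spectrum (dstar_mup0 R ds).
- by rewrite sE (dstar_cubic_eigenvalue ds) // lt_eqF.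
(* Of the three possible kinds of eigenvalue, 0 is excluded by positivity and 1 by the root
   [r < 1]. *)
move=> ns n0 nr; have n1 := le_lt_trans nr r1; split; first by rewrite n0.
by case: (sP _ ns) => // e; rewrite e ltxx in n0 n1.
Qed.

Lemma dstar_connectivity_leif (R : rcfType) (G H : sgraph) (a b : G)
    (c : G -> G) (a' b' : H) (c' : H -> H) :
  double_star a b c -> double_star a' b' c' -> #|G| = #|H| ->
  (#|G| <= deg a * deg b)%N -> (deg a * deg b <= deg a' * deg b')%N ->
  algebraic_connectivity R H <= algebraic_connectivity R G
    ?= iff (deg a * deg b == deg a' * deg b')%N.
Proof.
move=> dG dH GH le1 le2.
have [iG gG] := dstar_connectivity R dG le1.
have [iH gH] := dstar_connectivity R dH
  (leq_trans (eq_leq (esym GH)) (leq_trans le1 le2)).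
rewrite -GH in gH; rewrite -(eqr_nat R).
apply: dstar_cubic_root_le gG gH; rewrite ?ler_nat ?ler1n //.
by apply/card_gt0P; exists a.
Qed.

Local Open Scope nat_scope.

(** * Connected graphs with all but two vertices pendant *)

Lemma dstar_conn_pendant (G : sgraph) (a b : G) (c : G -> G) :
  double_star a b c -> 1 < deg a -> 1 < deg b ->
  conn_pendant_class #|G| (#|G| - 2) G.
Proof.
move=> ds a1 b1; have csym : connect_sym (@adj G) by apply/sym_connect_sym/adj_sym.
split=> //.
  split; first by apply/card_gt0P; exists a.
  have ba : connect (@adj G) b a.
    by apply/connect1; rewrite (dstar_adj ds) (dstar_b ds) eqxx.
  suff xa x : connect (@adj G) x a.
    by move=> x y; apply: connect_trans (xa x) _; rewrite csym.
  apply: (@connect_trans _ _ (c x)).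
    by apply: connect1; rewrite (dstar_adj ds) eqxx.
  by case/orP: (dstar_hub ds x) => /eqP->.
have -> : pendant G = ~: [set a; b].
  apply/setP => x; rewrite !inE negb_or.
  have [->|xa] := eqVneq x a; first by rewrite gtn_eqF.
  have [->|xb] := eqVneq x b; first by rewrite gtn_eqF.
  rewrite /deg (_ : [set y | _] = [set c x]) ?cards1 //.
  by apply/setP => y; rewrite !inE (dstar_adj_leaf ds).
by rewrite cardsCs setCK cards2 (dstar_neq ds).
Qed.

Lemma connected_closed (G : sgraph) (A : {set G}) (x : G) :
  connected G -> (forall y z, adj y z -> y \in A -> z \in A) -> x \in A ->
  forall y, y \in A.
Proof.
move=> [_ Gc] Acl xA y; rewrite -(@closed_connect _ (@adj G) A _ x y) //.
by apply: intro_closed => [|u v]; [exact: sym_connect_sym (@adj_sym G) | exact: Acl].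
Qed.

Lemma pendantP (G : sgraph) (x : G) :
  reflect (exists y, forall z, adj x z = (z == y)) (x \in pendant G).
Proof.
rewrite inE /deg; apply: (iffP cards1P) => [[y xy]|[y xy]]; exists y.
  by move=> z; move/setP/(_ z): xy; rewrite !inE.
by apply/setP => z; rewrite !inE xy.
Qed.

(** Two adjacent pendant vertices would form a whole connected component. *)
Lemma pendant_adj (G : sgraph) (x y : G) :
  connected G -> 2 < #|G| -> x \in pendant G -> adj x y -> y \notin pendant G.
Proof.
move=> Gc G3 /pendantP[x' xP] xy; apply/negP => /pendantP[y' yP].
have yE : y = x' by apply/eqP; rewrite -xP.
have xE : x = y' by apply/eqP; rewrite -yP adj_sym.
have cl : forall u v : G, adj u v -> u \in [set x; y] -> v \in [set x; y].
  move=> u v uv; rewrite !inE => /orP[]/eqP uE; move: uv; rewrite uE ?xP ?yP.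
    by rewrite -yE => ->; rewrite orbT.
  by rewrite -xE => ->.
have := subset_leq_card (introT subsetP (fun z (_ : z \in [set: G]) =>
  connected_closed Gc cl (set21 x y) z)).
by rewrite cardsT cards2; case: (x != y); lia.
Qed.

Lemma conn_pendant_dstar (G : sgraph) :
  2 < #|G| -> conn_pendant_class #|G| (#|G| - 2) G ->
  exists a b c, [/\ @double_star G a b c, 1 < deg a & 1 < deg b].
Proof.
move=> G3 [Gc _ Gp].
have : #|~: pendant G| == 2 by have := cardsC (pendant G); rewrite Gp; lia.
case/cards2P => a [b [ab pE]].
have npE x : (x \notin pendant G) = (x == a) || (x == b).
  by rewrite -in_setC pE !inE.
(* For a pendant vertex [pick] finds its only neighbour, so the default [x] is not returned
   there. *)
pose c x := if x == a then b else if x == b then a else odflt x [pick y | adj x y].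
have ca : c a = b by rewrite /c eqxx.
have cb : c b = a by rewrite /c eq_sym (negPf ab) eqxx.
have cP x : x != a -> x != b ->
    (forall y, adj x y = (y == c x)) /\ (c x == a) || (c x == b).
  move=> xa xb; have xp : x \in pendant G.
    by apply: contraTT xa; rewrite npE (negPf xb) orbF negbK.
  have /pendantP[y xy] := xp.
  have -> : c x = y.
    rewrite /c (negPf xa) (negPf xb); case: pickP => [z|/(_ y)].
      by rewrite xy => /eqP.
    by rewrite xy eqxx.
  by split=> //; rewrite -npE (pendant_adj Gc G3 xp) // xy.
have abE : adj a b.
  apply: contraT => nab.
  (* If [a] and [b] were not adjacent, [a] with its leaves would be closed under adjacency and miss
     [b], against connectedness. *)
  have cl : forall u v : G,
      adj u v -> u \in [set y | (c y == a) && (y != b) || (y == a)] ->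
      v \in [set y | (c y == a) && (y != b) || (y == a)].
    move=> u v uv; rewrite !inE; have [uE _|ua] := eqVneq u a.
      have [//|va] := eqVneq v a; first by rewrite orbT.
      have vb : v != b by apply: contraNneq nab => <-; rewrite -uE.
      have [vP _] := cP v va vb.
      by move: uv; rewrite adj_sym vP uE eq_sym vb => ->.
    rewrite orbF => /andP[/eqP cu ub]; have [uP _] := cP u ua ub.
    by move: uv; rewrite uP cu => ->; rewrite orbT.
  have := connected_closed Gc cl (x := a); rewrite !inE eqxx orbT => /(_ isT b).
  by rewrite !inE eqxx andbF /= eq_sym (negPf ab).
have hub x : (c x == a) || (c x == b).
  have [->|xa] := eqVneq x a; first by rewrite ca eqxx orbT.
  have [->|xb] := eqVneq x b; first by rewrite cb eqxx.
  by have [] := cP x xa xb.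
have ds : double_star a b c.
  split=> // x y.
  (* Stated for generic [u] and [v] to serve both centres. *)
  have hubE u v : c u = v -> c v = u -> adj u v ->
      (forall w, w != u -> w != v -> w != a /\ w != b) ->
      forall w, adj u w = (c u == w) || (c w == u).
    move=> cu cv uv nuv w; rewrite cu.
    have [<-|vw] := eqVneq v w; first by rewrite uv.
    have [->|wu] := eqVneq w u.
      rewrite adj_irrefl cu; apply/esym; apply: contraTF uv => /eqP->.
      by rewrite adj_irrefl.
    have [|wa wb] := nuv w wu; first by rewrite eq_sym.
    by have [wP _] := cP w wa wb; rewrite adj_sym wP eq_sym.
  have [->|xa] := eqVneq x a; first by apply: (hubE a b).
  have [->|xb] := eqVneq x b; first by apply: (hubE b a); rewrite 1?adj_sym.
  have [xP _] := cP x xa xb; rewrite xP eq_sym; case: eqP => //= _.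
  by case/orP: (hub y) => /eqP->; rewrite eq_sym; apply/esym/negbTE.
have deg1 x y : adj x y -> x \notin pendant G -> 1 < deg x.
  rewrite inE ltn_neqAle eq_sym => xy -> /=.
  by apply/card_gt0P; exists y; rewrite inE.
exists a, b, c; split=> //.
  by apply: deg1 abE _; rewrite npE eqxx.
by apply: (deg1 b a); rewrite ?npE ?eqxx ?orbT // adj_sym.
Qed.

(** * Double stars with equal degrees are isomorphic *)

(** The other centre comes first, so that matching two such lists by position sends centres to
    centres. *)
Definition dstar_nbrs (G : sgraph) (a b : G) (c : G -> G) : seq G :=
  b :: enum [pred y | (c y == a) && (y != b)].

Lemma mem_dstar_nbrs (G : sgraph) (a b : G) (c : G -> G) :
  double_star a b c -> forall y, (y \in dstar_nbrs a b c) = (c y == a).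
Proof.
move=> ds y; rewrite inE mem_enum inE; have [->|_] := eqVneq y b.
  by rewrite (dstar_b ds) eqxx.
by rewrite andbT.
Qed.

Lemma uniq_dstar_nbrs (G : sgraph) (a b : G) (c : G -> G) :
  uniq (dstar_nbrs a b c).
Proof. by rewrite /= enum_uniq mem_enum inE eqxx andbF. Qed.

Lemma size_dstar_nbrs (G : sgraph) (a b : G) (c : G -> G) :
  double_star a b c -> size (dstar_nbrs a b c) = deg a.
Proof.
by move=> ds; rewrite /= -cardE (dstar_card_leaves ds) prednK ?(dstar_deg_gt0 ds).
Qed.

(** Neighbours of corresponding centres are matched by position. The resulting map intertwines [c]
    and [c'], and adjacency is expressed through these, so injectivity suffices to preserve and
    reflect it. *)
Lemma double_star_isomorphic (G H : sgraph) (a b : G) (c : G -> G)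
    (a' b' : H) (c' : H -> H) :
  double_star a b c -> double_star a' b' c' -> deg a = deg a' ->
  deg b = deg b' -> isomorphic G H.
Proof.
move=> dG dH daa dbb; have dG' := double_starC dG; have dH' := double_starC dH.
pose f x := if c x == a
  then nth b' (dstar_nbrs a' b' c') (index x (dstar_nbrs a b c))
  else nth a' (dstar_nbrs b' a' c') (index x (dstar_nbrs b a c)).
have ab := negbTE (dstar_neq dG); have ab' := negbTE (dstar_neq dH).
have fa : f a = a' by rewrite /f (dstar_a dG) eq_sym ab /= eqxx.
have fb : f b = b' by rewrite /f (dstar_b dG) eqxx /= eqxx.
have cNa x : (c x == a) = false -> c x == b.
  by move=> cx; have := dstar_hub dG x; rewrite cx.
have lta x : c x == a -> index x (dstar_nbrs a b c) < size (dstar_nbrs a' b' c').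
  move=> cx; rewrite (size_dstar_nbrs dH) -daa -(size_dstar_nbrs dG).
  by rewrite index_mem mem_dstar_nbrs.
have ltb x : (c x == a) = false ->
    index x (dstar_nbrs b a c) < size (dstar_nbrs b' a' c').
  move=> cx; rewrite (size_dstar_nbrs dH') -dbb -(size_dstar_nbrs dG').
  by rewrite index_mem mem_dstar_nbrs // cNa.
have fc x : c' (f x) = f (c x).
  rewrite {1}/f; case: ifP => cx.
    by rewrite (eqP cx) fa; apply/eqP; rewrite -(mem_dstar_nbrs dH) mem_nth ?lta.
  by rewrite (eqP (cNa _ cx)) fb; apply/eqP; rewrite -(mem_dstar_nbrs dH') mem_nth ?ltb.
(* Applying [c'] to the images shows that both points lie in the same fibre of [c]; within one fibre
   the position determines the point. *)
have f_inj : injective f.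
  move=> x y fxy; have := congr1 c' fxy; rewrite !fc.
  have cE z : f (c z) = if c z == a then a' else b'.
    by case: ifP => [/eqP->//|/cNa/eqP->].
  have ba' : (b' == a') = false by rewrite eq_sym.
  rewrite !cE => cxy; have {}cxy : (c y == a) = (c x == a).
    by case: (c x == a) (c y == a) cxy => [] [] // /eqP; rewrite ?ab' ?ba'.
  move: fxy; rewrite /f cxy; case: ifP => cx; rewrite cx in cxy => /eqP.
    rewrite nth_uniq ?uniq_dstar_nbrs ?lta // => /eqP.
    by apply: (index_inj b); rewrite mem_dstar_nbrs.
  rewrite nth_uniq ?uniq_dstar_nbrs ?ltb // => /eqP.
  by apply: (index_inj b); rewrite mem_dstar_nbrs // cNa.
exists f.
  by apply: inj_card_bij => //; rewrite -(dstar_degD dG) -(dstar_degD dH) daa dbb.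
by move=> x y; rewrite (dstar_adj dG) (dstar_adj dH) !fc !(inj_eq f_inj).
Qed.

(** * The broom as a double star, and the extremal theorem *)

(** The middle vertex of the path is the centre of degree 2; the other centre is the end vertex
    [ord0], which carries the added leaves. *)
Definition broom_centre (n : nat) : P_broom n := inl (Ordinal (isT : 1 < 3)).

Definition broom_hub (n : nat) (x : P_broom n) : P_broom n :=
  match x with
  | inl i => if i == ord0 then broom_centre n
             else if i == ord_max then broom_centre n else inl ord0
  | inr _ => inl ord0
  end.

Lemma broom_double_star (n : nat) :
  double_star (inl ord0 : P_broom n) (broom_centre n) (@broom_hub n).
Proof.
apply: DoubleStar => //; first by case=> [[[|[|[|]]] ?]|?].
by case=> [[[|[|[|?]]] ?]|?]; case=> [[[|[|[|?]]] ?]|?].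
Qed.

Lemma card_broom (n : nat) : 3 <= n -> #|P_broom n| = n.
Proof. by move=> n3; rewrite card_sum !card_ord subnKC. Qed.

Lemma deg_broom_centre (n : nat) : deg (broom_centre n) = 2.
Proof.
rewrite /deg (_ : [set y | _] = [set inl ord0; inl ord_max]) ?cards2 //.
by apply/setP => y; rewrite !inE; case: y => [[[|[|[|?]]] ?]|?].
Qed.

Theorem theorem4p4 (R : rcfType) (n : nat) (hn : (4 <= n)%N) :
  attains_max_connectivity R (conn_pendant_class n (n - 2)) (P_broom n) /\
  (forall G : sgraph,
     attains_max_connectivity R (conn_pendant_class n (n - 2)) G ->
     isomorphic G (P_broom n)).
Proof.
have dB := broom_double_star n.
have cardB : #|P_broom n| = n by apply: card_broom; lia.
have degB := deg_broom_centre n.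
have degA : deg (inl ord0 : P_broom n) = n - 2.
  by have := dstar_degD dB; rewrite degB cardB; lia.
have classB : conn_pendant_class n (n - 2) (P_broom n).
  rewrite -{1 2}cardB; apply: (dstar_conn_pendant dB); rewrite ?degB ?degA; lia.
have dsG G : conn_pendant_class n (n - 2) G ->
    exists a b c, [/\ @double_star G a b c, 1 < deg a, 1 < deg b,
      deg a + deg b = n
    & (algebraic_connectivity R G <= algebraic_connectivity R (P_broom n)
        ?= iff ((n - 2) * 2 == deg a * deg b)%N)%R].
  move=> cG; have [_ Gn _] := cG; rewrite -Gn in cG.
  have [|a [b [c [ds a1 b1]]]] := conn_pendant_dstar _ cG; first by lia.
  have dab := dstar_degD ds; rewrite Gn in dab.
  have := dstar_connectivity_leif R dB ds; rewrite degA degB cardB => leif_ab.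
  (* With [p, q >= 2] and [p + q = n], the inequality [(p - 2) * (q - 2) >= 0] gives
     [p * q >= 2 * (n - 2)], and [2 * (n - 2) >= n] because [n >= 4]. *)
  by exists a, b, c; split=> //; apply: leif_ab; rewrite ?Gn //; nia.
split.
  by split=> // H /dsG[a [b [c [_ _ _ _]]]] /leifP; case: ifP => _ => [/eqP->|/ltW].
move=> G [cG /(_ _ classB)]; have [a [b [c [ds a1 b1 ab leif_ab]]]] := dsG G cG.
(* Maximality of [G] gives the reverse inequality, hence the equality case. *)
rewrite (ge_leif leif_ab) => /eqP e.
(* The equality of products says [(p - 2) * (q - 2) = 0]. *)
have [b2|a2] : deg b = 2 \/ deg a = 2 by nia.
  by apply: (double_star_isomorphic ds dB); lia.
by apply: (double_star_isomorphic (double_starC ds) dB); lia.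
Qed.
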